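(* (Focusing theorem.) In the on-average Friedmann universe setting of the context, with $\mathcal{R}_{\rm cl}\le0$, let $a(\lambda)=\operatorname{sign}(\det A(\lambda))\sqrt{|\det A(\lambda)|}$ with $A(\lambda)=\mathcal{D}(\lambda)/D(\lambda)$ for $\lambda>0$ and $a(0)=1$, and let $\mu(\lambda)=1/|\det A(\lambda)|$ be the magnification relative to the empty beam. Let $\lambda_c$ be the first conjugate point of the beam, i.e. the smallest $\lambda>0$ with $\det\mathcal{D}(\lambda)=0$. Then for $0\le\lambda\le\lambda_c$ $$1\ge a(\lambda)\ge0,\qquad\text{equivalently}\qquad \mu(\lambda)\ge1$$ (with $\mu=\infty$ where $\det A=0$). Moreover, as long as the beam has not passed a conjugate point, $a$ is monotonically decreasing (non-increasing) in $\lambda$. If there is no conjugate point, the same holds for all $\lambda$.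
   Context: Dots denote $d/d\lambda$. Constants $c,H_0>0$, density parameter $\Omega\ge0$, $\tilde\alpha\in[0,1]$. The affine parameter and the redshift $z\ge0$ are related by $\lambda(z)=\frac{c}{H_0}\int_0^z\frac{dz'}{(1+z')^3\sqrt{\Omega z'+1}}$. The background source of convergence is $\mathcal{R}_{\rm bg}=-\frac32\left(\frac{H_0}{c}\right)^2\tilde\alpha\,\Omega\,(1+z)^5$. The empty-cone angular diameter distance $D(\lambda)$ is the solution of $\ddot D=\mathcal{R}_{\rm bg}D$, $D(0)=0$, $\dot D(0)=1$; it is positive for $\lambda>0$. The optical tidal matrix is $$\mathcal{T}=\begin{pmatrix}\mathcal{R}-\operatorname{Re}\mathcal{F}&\operatorname{Im}\mathcal{F}\\ \operatorname{Im}\mathcal{F}&\mathcal{R}+\operatorname{Re}\mathcal{F}\end{pmatrix},\qquad \mathcal{R}=\mathcal{R}_{\rm bg}+\mathcal{R}_{\rm cl},$$ with $\mathcal{R}_{\rm cl}$ real and $\mathcal{F}$ complex valued (contributions of matter clumps), continuous in $\lambda$; $\mathcal{R}_{\rm cl}\le0$ because clumps have non-negative density. The Jacobi map $\mathcal{D}$ solves $\ddot{\mathcal{D}}=\mathcal{T}\mathcal{D}$, $\mathcal{D}(0)=0$, $\dot{\mathcal{D}}(0)=I$ ($2\times2$ matrices). *)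

(* Defs.v *)
(* MathComp-Analysis, over an arbitrary real number structure [R : realType]. *)
From HB Require Import structures.
From mathcomp Require Import all_boot all_order all_algebra.
From mathcomp Require Import complex.
From mathcomp Require Import all_classical all_reals all_analysis.
Import Order.TTheory GRing.Theory Num.Theory.
Import numFieldNormedType.Exports.

Set Implicit Arguments.
Unset Strict Implicit.
Unset Printing Implicit Defensive.

Local Open Scope classical_set_scope.
Local Open Scope ring_scope.

(* Derivative relative to [S]: two-sided at interior points of [S], one-sided
   at an end point belonging to [S].  The values of [f] outside [S] are
   irrelevant, so that functions defined only along the beam can be
   represented by total functions. *)
Definition is_derive_within (R : realType) (V : normedModType R) (S : set R)
    (f : R -> V) (x : R) (df : V) : Prop :=
  (fun y => (y - x)^-1 *: (f y - f x)) @ within S x^' --> df.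

Definition solves_ivp2 (R : realType) (V : normedModType R) (S : set R)
    (rhs : R -> V -> V) (v0 v1 : V) (f : R -> V) : Prop :=
  exists df : R -> V,
    [/\ forall l, S l -> is_derive_within S f l (df l),
        forall l, S l -> is_derive_within S df l (rhs l (f l)),
        f 0 = v0
      & df 0 = v1].

Definition affine_parameter (R : realType) (c H0 Omega z : R) : R :=
  c / H0 * \int[lebesgue_measure]_(x in `[0, z])
             ((1 + x) ^+ 3 * Num.sqrt (Omega * x + 1))^-1.

(* The affine parameter is bounded as z -> +oo, so the beam is the interval of
   the values that it takes, not the whole half line. *)
Definition beam (R : realType) (c H0 Omega : R) : set R :=
  affine_parameter c H0 Omega @` `[0, +oo[.

(* The inverse of the affine parameter; the value 0 outside the beam is
   junk. *)
Definition redshift (R : realType) (c H0 Omega : R) : R -> R :=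
  'pinv_(fun=> 0) `[0, +oo[ (affine_parameter c H0 Omega).

Definition R_bg (R : realType) (c H0 Omega alpha l : R) : R :=
  - (3 / 2) * (H0 / c) ^+ 2 * alpha * Omega
    * (1 + redshift c H0 Omega l) ^+ 5.

Definition tidal_matrix (R : realType) (r : R) (F : R[i]) : 'M[R]_2 :=
  \matrix_(i < 2, j < 2)
    if i == j then (if i == 0 then r - complex.Re F else r + complex.Re F)
    else complex.Im F.

(* At l = 0 the quotient is 0 / 0; its limit there is the identity, which
   yields [signed_amplitude _ _ 0 = 1]. *)
Definition amplification (R : realType) (Demp : R -> R) (J : R -> 'M[R]_2)
    (l : R) : 'M[R]_2 :=
  if l == 0 then 1%:M else (Demp l)^-1 *: J l.

Definition signed_amplitude (R : realType) (Demp : R -> R) (J : R -> 'M[R]_2)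
    (l : R) : R :=
  let d := \det (amplification Demp J l) in Num.sg d * Num.sqrt `|d|.

Definition magnification (R : realType) (Demp : R -> R) (J : R -> 'M[R]_2)
    (l : R) : \bar R :=
  let d := \det (amplification Demp J l) in
  if d == 0 then +oo%E else (`|d|^-1)%:E.

Definition conjugate_point (R : realType) (S : set R) (J : R -> 'M[R]_2)
    (l : R) : Prop :=
  [/\ S l, 0 < l & \det (J l) = 0].

Definition first_conjugate_point (R : realType) (S : set R)
    (J : R -> 'M[R]_2) (lc : R) : Prop :=
  conjugate_point S J lc /\ forall l, conjugate_point S J l -> lc <= l.

(* Main.v *)
(* Put delta = det J and y = sqrt delta.  Since the tidal matrix is symmetric,
   J^T J' is symmetric, so N = J' adj J is a symmetric matrix and
   4 delta det J' = 4 det N <= (tr N)^2 = delta'^2.  As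
   delta'' = 2 R delta + 2 det J', this gives y'' <= R y <= R_bg y as long as
   y > 0, while D'' = R_bg D.  Hence the Wronskian D' y - D y' is nondecreasing
   and vanishes at 0, so that a = y / D is nonincreasing, with limit 1 at 0.
   The positivity of D comes from the same Sturm comparison, against the
   explicit positive solution sqrt (Omega z + 1) / (1 + z)^2 of the equation
   for alpha = 1. *)
Require Import Defs.
From mathcomp Require Import all_boot all_order all_algebra.
From mathcomp Require Import complex.
From mathcomp Require Import all_classical all_reals all_analysis.
From mathcomp Require Import ring lra.
Import Order.TTheory GRing.Theory Num.Theory.
Import numFieldNormedType.Exports.

Local Open Scope classical_set_scope.
Local Open Scope ring_scope.

(** * Monotone functions on an open interval and their right limit at 0 *)

Lemma is_derive_continuous (R : realType) (f : R -> R) (x df : R) :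
  is_derive x 1 f df -> {for x, continuous f}.
Proof. by move=> [/derivable1_diffP + _]; exact: differentiable_continuous. Qed.

Lemma ge0_derive_homo (R : realType) (h dh : R -> R) (b : R) :
  (forall x, 0 < x < b -> is_derive x 1 h (dh x)) ->
  (forall x, 0 < x < b -> 0 <= dh x) ->
  forall s t, 0 < s -> s <= t -> t < b -> h s <= h t.
Proof.
move=> hd dh0 s t s0 st tb.
apply: (@ger0_derive1_le_oo R h 0 b) => //.
- by move=> x; rewrite in_itv/= => /hd [].
- move=> x; rewrite in_itv/= => xb; rewrite derive1E.
  by have [_ ->] := hd _ xb; exact: dh0.
- by move=> x; rewrite inE/= in_itv/= => /hd; exact: is_derive_continuous.
- by rewrite in_itv/= s0 (le_lt_trans st).
- by rewrite in_itv/= tb (lt_le_trans s0).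
Qed.

(** Initial data enter the comparison arguments only through limits at [0^'+]: the beam starts at 0,
    where no two-sided derivative is available. *)
Lemma ge0_derive_ge_lim (R : realType) (h dh : R -> R) (b l : R) :
  (forall x, 0 < x < b -> is_derive x 1 h (dh x)) ->
  (forall x, 0 < x < b -> 0 <= dh x) ->
  h x @[x --> 0^'+] --> l ->
  forall x, 0 < x < b -> l <= h x.
Proof.
move=> hd dh0 hl x /andP[x0 xb].
have <- : lim (h t @[t --> 0^'+]) = l by exact: cvg_lim hl.
apply: limr_le; first exact: cvgP hl.
near=> t; apply: (ge0_derive_homo _ _ _ _ hd dh0) => //.
by near: t; exact: nbhs_right_ltW.
Unshelve. all: by end_near. Qed.

(** * From derivatives within a set to ordinary derivatives and one-sided limits *)

Lemma is_derive_within_coord (R : realType) (m n : nat) (S : set R)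
    (f : R -> 'M[R]_(m, n)) (x : R) (df : 'M[R]_(m, n)) i j :
  is_derive_within S f x df ->
  is_derive_within S (fun y => f y i j : R) x (df i j).
Proof.
move=> h; rewrite /is_derive_within.
apply: cvg_trans (cvg_comp _ _ h (@coord_continuous _ _ _ i j df)); apply: near_eq_cvg; near=> y.
by rewrite /= !mxE.
Unshelve. all: by end_near. Qed.

(** When [S] is a neighbourhood of [x], restricting [x^'] to [S] changes nothing. The difference
    quotient, completed by [df] at [x], is then the slope function of Caratheodory's criterion. *)
Lemma is_derive_within_interior (R : realType) (S : set R) (f : R -> R)
    (x df : R) :
  nbhs x S -> is_derive_within S f x df -> is_derive x 1 f df.
Proof.
move=> Sx h; apply/is_derive1_caratheodory.
exists (fun z => if z == x then df else (z - x)^-1 * (f z - f x)); split.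
- move=> z; case: eqVneq => [->|zx]; first by rewrite !subrr mulr0.
  by rewrite mulrAC mulVf ?mul1r// subr_eq0.
- apply/continuous_withinNx; rewrite eqxx.
  have : (fun y => (y - x)^-1 *: (f y - f x)) @ x^' --> df.
    apply: cvg_trans h; apply: cvg_app.
    move=> A SA; apply: (@filterS2 _ x^' _ [set y | S y -> A y] S A).
    - by move=> y; exact.
    - exact: SA.
    - exact: nbhs_dnbhs.
  apply: cvg_trans; apply: near_eq_cvg; near=> y.
  rewrite ifF//; apply/negbTE; near: y; exact: nbhs_dnbhs_neq.
- by rewrite eqxx.
Unshelve. all: by end_near. Qed.

Lemma nbhs_dnbhs_within_right (R : realType) (S : set R) (x y : R) :
  x < y -> (forall z, x <= z <= y -> S z) ->
  x^'+ `=>` within S x^'.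
Proof.
move=> xy Sxy A SA.
apply: (@filterS2 _ x^'+ _ [set z | z != x -> S z -> A z]
                  [set z | x < z <= y] A).
- move=> z zA /andP[xz zy]; apply: zA; first by rewrite gt_eqF.
  by apply: Sxy; rewrite (ltW xz).
- exact: (@cvg_within _ (nbhs x) _ (fun u => x < u) _ SA).
- by near=> z; apply/andP; split; near: z; [exact: nbhs_right_gt|
    exact: nbhs_right_ltW].
Unshelve. all: by end_near. Qed.

(** This turns the initial slope at the end point 0 of the beam into an asymptotic equivalent of [f]
    at [0^'+]. *)
Lemma is_derive_within_right_quotient (R : realType) (S : set R) (f : R -> R)
    (y df : R) :
  0 < y -> (forall z, 0 <= z <= y -> S z) ->
  f 0 = 0 -> is_derive_within S f 0 df -> f x / x @[x --> 0^'+] --> df.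
Proof.
move=> y0 Sy f0 h.
have : (fun z => (z - 0)^-1 *: (f z - f 0)) @ 0^'+ --> df.
  by apply: cvg_trans h; apply: cvg_app; exact: nbhs_dnbhs_within_right Sy.
apply: cvg_trans; apply: near_eq_cvg; near=> z.
by rewrite f0 !subr0 [RHS]mulrC.
Unshelve. all: by end_near. Qed.

Lemma is_derive_within_right_cvg (R : realType) (S : set R) (f : R -> R)
    (y df : R) :
  0 < y -> (forall z, 0 <= z <= y -> S z) ->
  is_derive_within S f 0 df -> f x @[x --> 0^'+] --> f 0.
Proof.
move=> y0 Sy h.
have id0 : (fun x : R => x) @ 0^'+ --> (0 : R) by exact: cvg_at_right_filter.
(* For [z != 0] this expression is [f z]. *)
have : (fun z => f 0 + (z - 0)^-1 *: (f z - f 0) * z) @ 0^'+ --> f 0 + df * 0.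
  apply: cvgD; first exact: cvg_cst.
  apply: cvgM => //.
  by apply: cvg_trans h; apply: cvg_app; exact: nbhs_dnbhs_within_right Sy.
rewrite mulr0 addr0; apply: cvg_trans; apply: near_eq_cvg; near=> z.
have z0 : z != 0 by rewrite gt_eqF.
by rewrite subr0 -[_ *: _]/(z^-1 * (f z - f 0)); field.
Unshelve. all: by end_near. Qed.

(** * Sturm comparison *)

(** The derivative of [f / g] is [W / g^2] with the Wronskian [W = f1 g - f g1]. Since
    [W' = f2 g - f g2 >= 0], [W] stays above its limit [w >= 0] at 0. *)
Lemma sturm_ratio_homo (R : realType) (f f1 f2 g g1 g2 : R -> R) (b w : R) :
  (forall x, 0 < x < b -> is_derive x 1 f (f1 x)) ->
  (forall x, 0 < x < b -> is_derive x 1 f1 (f2 x)) ->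
  (forall x, 0 < x < b -> is_derive x 1 g (g1 x)) ->
  (forall x, 0 < x < b -> is_derive x 1 g1 (g2 x)) ->
  (forall x, 0 < x < b -> 0 < g x) ->
  (forall x, 0 < x < b -> f x * g2 x <= f2 x * g x) ->
  0 <= w -> f1 x * g x - f x * g1 x @[x --> 0^'+] --> w ->
  forall s t, 0 < s -> s <= t -> t < b -> f s / g s <= f t / g t.
Proof.
move=> fd f1d gd g1d g0 cmp w0 wl.
apply: (@ge0_derive_homo R _ (fun x => (f1 x * g x - f x * g1 x) / g x ^+ 2)).
- move=> x xb; have gx0 := lt0r_neq0 (g0 _ xb).
  have := is_deriveM (fd _ xb) (is_deriveV gx0 (gd _ xb)).
  move=> H; apply: (is_derive_eq H).
  rewrite -[_ *: _]/(_ * (_ * _)) -[_ *: _]/(_ * _).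
  by field.
- move=> x xb; apply: divr_ge0; last exact: sqr_ge0.
  apply: le_trans w0 _.
  apply: (@ge0_derive_ge_lim R (fun x => f1 x * g x - f x * g1 x)
           (fun x => f2 x * g x - f x * g2 x) b) => //.
  + move=> y yb.
    have := is_deriveB (is_deriveM (f1d _ yb) (gd _ yb))
                       (is_deriveM (fd _ yb) (g1d _ yb)).
    move=> H; apply: (is_derive_eq H).
    rewrite -![_ *: _]/(_ * _); ring.
  + by move=> y yb; rewrite subr_ge0 cmp.
Qed.

(** The witness is the infimum of the points of [[s, t]] where [f <= 0]; continuity makes [f]
    nonpositive there too. *)
Lemma first_nonpos (R : realType) (f : R -> R) (s t : R) :
  s <= t -> (forall x, s <= x <= t -> {for x, continuous f}) ->
  0 < f s -> f t <= 0 ->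
  exists x, [/\ s < x <= t, f x <= 0 & forall y, s <= y < x -> 0 < f y].
Proof.
move=> st fc fs ft.
pose E : set R := [set x | s <= x <= t /\ f x <= 0].
have Et : E t by split; rewrite // st lexx.
have Elb : has_lbound E by exists s => x [/andP[]].
have sE : s <= inf E by apply: lb_le_inf; [exists t|move=> x [/andP[]]].
have Et' : inf E <= t by exact: ge_inf.
have fE : f (inf E) <= 0.
  rewrite leNgt; apply/negP => fE0.
  have fcE : {for inf E, continuous f} by apply: fc; rewrite sE.
  have /nbhs_ballP[e /= e0 fe] : \forall y \near inf E, 0 < f y.
    exact: cvgr_gt fcE _ fE0.
  have [x Ex xe] := inf_adherent e0 (conj (ex_intro _ t Et) Elb).
  have : 0 < f x.
    apply: fe; rewrite /ball/= distrC ger0_norm ?subr_ge0 ?ge_inf//.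
    by rewrite ltrBlDl.
  by rewrite ltNge Ex.2.
exists (inf E); split => //.
- rewrite Et' andbT lt_neqAle sE andbT; apply/eqP => sE'.
  by move: fE; rewrite -sE' leNgt fs.
- move=> y /andP[sy yE]; rewrite ltNge; apply/negP => fy.
  suff : inf E <= y by rewrite leNgt yE.
  apply: ge_inf => //; split => //; rewrite sy.
  exact: le_trans (ltW yE) Et'.
Qed.

(** The comparison is assumed only where [f] is positive. Before a first point [m] with [f m <= 0]
    it holds throughout, so [f / g] cannot fall from a positive value to [f m / g m <= 0]. *)
Lemma sturm_gt0 (R : realType) (f f1 f2 g g1 g2 : R -> R) (b w : R) :
  (forall x, 0 < x < b -> is_derive x 1 f (f1 x)) ->
  (forall x, 0 < x < b -> is_derive x 1 f1 (f2 x)) ->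
  (forall x, 0 < x < b -> is_derive x 1 g (g1 x)) ->
  (forall x, 0 < x < b -> is_derive x 1 g1 (g2 x)) ->
  (forall x, 0 < x < b -> 0 < g x) ->
  (forall x, 0 < x < b -> 0 < f x -> f x * g2 x <= f2 x * g x) ->
  0 <= w -> f1 x * g x - f x * g1 x @[x --> 0^'+] --> w ->
  (\forall x \near 0^'+, 0 < f x) ->
  forall x, 0 < x < b -> 0 < f x.
Proof.
move=> fd f1d gd g1d g0 cmp w0 wl f0 t /andP[t0 tb].
rewrite ltNge; apply/negP => ft.
have [s [/andP[s0 st] fs]] : exists s, 0 < s < t /\ forall y, 0 < y <= s -> 0 < f y.
  have [e /= e0 fe] := f0.
  exists (Num.min (e / 2) (t / 2)); split.
    by rewrite lt_min !divr_gt0//= gt_min; apply/orP; right; lra.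
  move=> y /andP[y0]; rewrite le_min => /andP[ye _]; apply: fe => //=.
  by rewrite sub0r normrN gtr0_norm//; lra.
have cf x : 0 < x < b -> {for x, continuous f}.
  by move=> /fd; exact: is_derive_continuous.
have [||m [/andP[sm mt] fm fpos]] := @first_nonpos R f s t (ltW st) _ _ ft.
- by move=> x /andP[sx xt]; apply: cf; rewrite (lt_le_trans s0)//= (le_lt_trans xt).
- by apply: fs; rewrite s0 lexx.
have m0 : 0 < m by exact: lt_trans sm.
have mb : m < b by exact: le_lt_trans tb.
have sub x : 0 < x < m -> 0 < x < b.
  by move=> /andP[-> xm]; rewrite (lt_trans xm).
have fposm x : 0 < x < m -> 0 < f x.
  move=> /andP[x0 xm]; have [xs|sx] := leP x s; first by apply: fs; rewrite x0.
  by apply: fpos; rewrite xm ltW.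
have mono := @sturm_ratio_homo R f f1 f2 g g1 g2 m w
  (fun x xb => fd x (sub x xb)) (fun x xb => f1d x (sub x xb))
  (fun x xb => gd x (sub x xb)) (fun x xb => g1d x (sub x xb))
  (fun x xb => g0 x (sub x xb)) (fun x xb => cmp x (sub x xb) (fposm x xb)) w0 wl.
have gm : 0 < g m by apply: g0; rewrite m0.
have cgm : {for m, continuous g}.
  have /gd : 0 < m < b by rewrite m0.
  exact: is_derive_continuous.
(* Monotonicity holds only strictly before [m]; a left limit carries it to [m]. *)
have fgm : f x / g x @[x --> m^'-] --> f m / g m.
  apply: cvg_at_left_filter; apply: cvgM; first by apply: cf; rewrite m0.
  by apply: cvgV => //; rewrite gt_eqF.
have : f s / g s <= f m / g m.
  have <- : lim (f x / g x @[x --> m^'-]) = f m / g m by exact: cvg_lim fgm.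
  apply: limr_ge; first exact: cvgP fgm.
  near=> y; apply: mono => //.
  near: y; exact: nbhs_left_ge.
rewrite leNgt => /negP; apply; apply: (@le_lt_trans _ _ 0).
  by rewrite pmulr_lle0 ?invr_gt0.
by rewrite divr_gt0 ?g0 ?fs ?s0 ?lexx// (lt_trans st).
Unshelve. all: by end_near. Qed.

(** * The focusing inequality in scalar form *)

(** The Jacobi equation acts on each column [(u, v)] separately; [r], [fr], [fi] stand for the
    convergence source and the real and imaginary parts of the shear source. *)
Definition jacobi_column {R : realType} (b : R) (r fr fi u v u1 v1 : R -> R) :=
  forall x, 0 < x < b ->
  [/\ is_derive x 1 u (u1 x), is_derive x 1 v (v1 x),
      is_derive x 1 u1 ((r x - fr x) * u x + fi x * v x)
    & is_derive x 1 v1 (fi x * u x + (r x + fr x) * v x)].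

(* The tidal matrix is symmetric, hence [J^T J'] is. *)
Lemma jacobi_wronskian0 (R : realType) (L : R)
    (r fr fi a c a1 c1 b d b1 d1 : R -> R) (la lc lb ld : R) :
  jacobi_column L r fr fi a c a1 c1 -> jacobi_column L r fr fi b d b1 d1 ->
  a x @[x --> 0^'+] --> (0 : R) -> c x @[x --> 0^'+] --> (0 : R) ->
  b x @[x --> 0^'+] --> (0 : R) -> d x @[x --> 0^'+] --> (0 : R) ->
  a1 x @[x --> 0^'+] --> la -> c1 x @[x --> 0^'+] --> lc ->
  b1 x @[x --> 0^'+] --> lb -> d1 x @[x --> 0^'+] --> ld ->
  forall x, 0 < x < L -> a x * b1 x + c x * d1 x = a1 x * b x + c1 x * d x.
Proof.
move=> Jac Jbd a0 c0 b0 d0 la1 lc1 lb1 ld1 x xL.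
pose w x := a x * b1 x + c x * d1 x - (a1 x * b x + c1 x * d x).
(* The columns vanish at 0 while their derivatives have finite limits. *)
have wl : w x @[x --> 0^'+] --> (0 : R).
  rewrite (_ : nbhs (0 : R) = nbhs (0 * lb + 0 * ld - (la * 0 + lc * 0))).
    by apply: cvgB; apply: cvgD; apply: cvgM.
  by congr (nbhs _); ring.
have wd y : 0 < y < L -> is_derive y 1 w 0.
  move=> yL; have [ad cd a1d c1d] := Jac _ yL; have [bd dd b1d d1d] := Jbd _ yL.
  have H := is_deriveB (is_deriveD (is_deriveM ad b1d) (is_deriveM cd d1d))
                       (is_deriveD (is_deriveM a1d bd) (is_deriveM c1d dd)).
  apply: (is_derive_eq H); rewrite -![_ *: _]/(_ * _); ring.
(* As [w' = 0], both [w] and [- w] lie above their common limit 0. *)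
apply/eqP; rewrite -subr_eq0 -/(w x); apply/eqP/le_anti/andP; split.
  rewrite -oppr_ge0; apply: (@ge0_derive_ge_lim R (fun x => - w x) (fun=> 0) L 0) => //.
  - move=> y yL; have H := is_deriveN (wd _ yL).
    by apply: (is_derive_eq H); rewrite oppr0.
  - by have := cvgN wl; rewrite oppr0; exact.
by apply: (@ge0_derive_ge_lim R w (fun=> 0) L 0).
Qed.

(* With [N = J' adj J], symmetric by the hypothesis, the discriminant
   [(tr N)^2 - 4 det N] is [(N 0 0 - N 1 1)^2 + 4 (N 0 1)^2]. *)
Lemma jacobi_discriminant_ge0 (R : realType) (a b c d a1 b1 c1 d1 : R) :
  a * b1 + c * d1 = a1 * b + c1 * d ->
  4 * (a * d - b * c) * (a1 * d1 - b1 * c1) <=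
    (a1 * d + a * d1 - (b1 * c + b * c1)) ^+ 2.
Proof.
move=> w0; rewrite -subr_ge0.
(* The last summand is [4 N01 (N10 - N01)], which [w0] cancels. *)
have -> : (a1 * d + a * d1 - (b1 * c + b * c1)) ^+ 2
    - 4 * (a * d - b * c) * (a1 * d1 - b1 * c1)
  = (a1 * d - b1 * c + c1 * b - d1 * a) ^+ 2 + 4 * (a * b1 - a1 * b) ^+ 2
    + 4 * (a * b1 - a1 * b) * (a1 * b + c1 * d - (a * b1 + c * d1)) by ring.
rewrite w0 subrr mulr0 addr0; apply: addr_ge0; first exact: sqr_ge0.
by rewrite mulr_ge0// sqr_ge0.
Qed.

(** The Jacobi map has columns [(a, c)] and [(b, d)]; [p] is the background source and [r] the total
    one. The end point [L] stays out because the square root is not differentiable where the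
    determinant vanishes. *)
Lemma focusing_scalar (R : realType) (L : R)
    (p r fr fi D D1 a c a1 c1 b d b1 d1 : R -> R) :
  let y := fun x => Num.sqrt (a x * d x - b x * c x) in
  jacobi_column L r fr fi a c a1 c1 -> jacobi_column L r fr fi b d b1 d1 ->
  (forall x, 0 < x < L -> is_derive x 1 D (D1 x)) ->
  (forall x, 0 < x < L -> is_derive x 1 D1 (p x * D x)) ->
  (forall x, 0 < x < L -> 0 < D x) ->
  (forall x, 0 < x < L -> r x <= p x) ->
  a x / x @[x --> 0^'+] --> (1 : R) -> c x / x @[x --> 0^'+] --> (0 : R) ->
  b x / x @[x --> 0^'+] --> (0 : R) -> d x / x @[x --> 0^'+] --> (1 : R) ->
  D x / x @[x --> 0^'+] --> (1 : R) ->
  a1 x @[x --> 0^'+] --> (1 : R) -> c1 x @[x --> 0^'+] --> (0 : R) ->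
  b1 x @[x --> 0^'+] --> (0 : R) -> d1 x @[x --> 0^'+] --> (1 : R) ->
  D1 x @[x --> 0^'+] --> (1 : R) ->
  (forall x, 0 < x < L -> 0 < a x * d x - b x * c x) ->
  (y x / D x @[x --> 0^'+] --> (1 : R)) /\
  forall s t, 0 < s -> s <= t -> t < L -> y t / D t <= y s / D s.
Proof.
move=> y Jac Jbd Dd D1d D0 rp ax cx bx dx Dx a1x c1x b1x d1x D1x det0.
have id0 : (fun x : R => x) @ 0^'+ --> (0 : R) by exact: cvg_at_right_filter.
have to0 (f : R -> R) (l : R) : f x / x @[x --> 0^'+] --> l -> f x @[x --> 0^'+] --> (0 : R).
  move=> fl; have : f x / x * x @[x --> 0^'+] --> (l * 0 : R) by exact: cvgM.
  rewrite mulr0; apply: cvg_trans; apply: near_eq_cvg.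
  near=> x; have x0 : x != 0 by rewrite gt_eqF.
  by rewrite /= divfK.
have wr := @jacobi_wronskian0 R L r fr fi a c a1 c1 b d b1 d1 _ _ _ _ Jac Jbd
  (to0 _ _ ax) (to0 _ _ cx) (to0 _ _ bx) (to0 _ _ dx) a1x c1x b1x d1x.
pose e x := a x * d x - b x * c x.
pose e1 x := a1 x * d x + a x * d1 x - (b1 x * c x + b x * c1 x).
(* The tidal matrix contributes to the second derivative of the determinant only by its trace [2 r];
   the shear terms cancel. *)
pose e2 x := 2 * r x * e x + 2 * (a1 x * d1 x - b1 x * c1 x).
have ed x : 0 < x < L -> is_derive x 1 e (e1 x).
  move=> xL; have [ad cd a1d c1d] := Jac _ xL; have [bd dd b1d d1d] := Jbd _ xL.
  have H := is_deriveB (is_deriveM ad dd) (is_deriveM bd cd).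
  apply: (is_derive_eq H); rewrite /e1 -![_ *: _]/(_ * _); ring.
have e1d x : 0 < x < L -> is_derive x 1 e1 (e2 x).
  move=> xL; have [ad cd a1d c1d] := Jac _ xL; have [bd dd b1d d1d] := Jbd _ xL.
  have H := is_deriveB (is_deriveD (is_deriveM a1d dd) (is_deriveM ad d1d))
                       (is_deriveD (is_deriveM b1d cd) (is_deriveM bd c1d)).
  apply: (is_derive_eq H); rewrite /e2 /e -![_ *: _]/(_ * _); ring.
have y0 x : 0 < x < L -> 0 < y x by move=> xL; rewrite sqrtr_gt0 det0.
have y2 x : 0 < x < L -> y x ^+ 2 = e x by move=> xL; rewrite sqr_sqrtr// ltW ?det0.
pose y1 x := e1 x / (2 * y x).
have yd x : 0 < x < L -> is_derive x 1 y (y1 x).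
  move=> xL; have H := @is_derive1_comp R Num.sqrt e x _ _
    (is_derive1_sqrt (det0 _ xL)) (ed _ xL).
  by apply: (is_derive_eq H); rewrite /y1 mulrC.
pose y2' x := e2 x / (2 * y x) - e1 x ^+ 2 / (4 * y x ^+ 3).
have y1d x : 0 < x < L -> is_derive x 1 y1 (y2' x).
  move=> xL; have yx0 := y0 _ xL.
  have ny0 : 2 * y x != 0 by rewrite mulf_neq0// gt_eqF.
  have H2y : is_derive x 1 (fun x => 2 * y x) (2 * y1 x).
    by have H := is_deriveZ 2 (yd _ xL); apply: (is_derive_eq H).
  have H := is_deriveM (e1d _ xL) (@is_deriveV R (fun z => 2 * y z) x _ 1 ny0 H2y).
  apply: (is_derive_eq H); rewrite -[_ *: _]/(_ * (_ * _)) -[_ *: _]/(_ * _).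
  by rewrite /y2' /y1; field; rewrite gt_eqF.
have concave x : 0 < x < L -> y2' x <= p x * y x.
  move=> xL; have yx0 := y0 _ xL.
  apply: (@le_trans _ _ (r x * y x)); last by rewrite ler_wpM2r ?rp// ltW.
  (* Multiplying by [4 y^3] leaves only powers of [y^2 = e], and the claim becomes the discriminant
     inequality [4 e det J' <= e1^2]. *)
  rewrite -subr_ge0 -(pmulr_rge0 _ (_ : 0 < 4 * y x ^+ 3)); last first.
    by rewrite mulr_gt0// exprn_gt0.
  have -> : 4 * y x ^+ 3 * (r x * y x - y2' x)
      = 4 * r x * (y x ^+ 2) ^+ 2 - 2 * e2 x * y x ^+ 2 + e1 x ^+ 2.
    by rewrite /y2'; field; rewrite gt_eqF.
  rewrite y2// /e2 -subr_ge0.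
  have := jacobi_discriminant_ge0 _ _ _ _ _ _ _ _ _ (wr _ xL).
  rewrite -subr_ge0; congr (0 <= _); rewrite -/(e x) -/(e1 x); ring.
have yx : y x / x @[x --> 0^'+] --> (1 : R).
  have h : a x / x * (d x / x) - b x / x * (c x / x) @[x --> 0^'+] --> (1 * 1 - 0 * 0 : R).
    by apply: cvgB; apply: cvgM.
  have := cvg_comp _ _ h (@sqrt_continuous R _).
  rewrite mulr1 mulr0 subr0 sqrtr1; apply: cvg_trans; apply: near_eq_cvg.
  near=> x; have x0 : 0 < x by [].
  have xi0 : 0 <= x^-1 ^+ 2 by exact: sqr_ge0.
  rewrite /= /y -[x^-1 in RHS]ger0_norm ?invr_ge0 ?(ltW x0)// -sqrtr_sqr.
  by rewrite [RHS]mulrC -sqrtrM//; congr (Num.sqrt _); ring.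
have e1x : e1 x / x @[x --> 0^'+] --> (2 : R).
  have : a1 x * (d x / x) + a x / x * d1 x - (b1 x * (c x / x) + b x / x * c1 x)
      @[x --> 0^'+] --> (1 * 1 + 1 * 1 - (0 * 0 + 0 * 0) : R).
    by apply: cvgB; apply: cvgD; apply: cvgM.
  rewrite (_ : 1 * 1 + 1 * 1 - (0 * 0 + 0 * 0) = 2 :> R); last by ring.
  by apply: cvg_trans; apply: near_eq_cvg; near=> x; rewrite /e1; ring.
have W0 : D1 x * y x - D x * y1 x @[x --> 0^'+] --> (0 : R).
  (* Near 0, [D ~ x], [e1 ~ 2 x] and [y ~ x], so [D y1 = D e1 / (2 y)] is of order [x]. *)
  have : D1 x * y x - D x / x * (e1 x / x) / (2 * (y x / x)) * x
      @[x --> 0^'+] --> (1 * 0 - 1 * 2 / (2 * 1) * 0 : R).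
    apply: cvgB; apply: cvgM => //; first exact: to0 yx.
    apply: cvgM; first exact: cvgM.
    by apply: cvgV; [by rewrite mulr1 pnatr_eq0|apply: cvgM => //; exact: cvg_cst].
  rewrite !mulr0 subr0; apply: cvg_trans; apply: near_eq_cvg; near=> x.
  have x0 : x != 0 by rewrite gt_eqF.
  (* Once the inverse is generalised, [field] asks for no proof that [y x] is nonzero. *)
  by rewrite /y1 !invfM !invrK; move: (y x)^-1 => z; field.
(* The comparison makes [D / y] nondecreasing; the amplitude is its reciprocal. *)
have Dy := sturm_ratio_homo _ _ _ _ _ _ _ L 0 Dd D1d yd y1d y0 _ _ W0.
split.
  have : y x / x / (D x / x) @[x --> 0^'+] --> (1 / 1 : R).
    by apply: cvgM => //; apply: cvgV.
  rewrite divr1; apply: cvg_trans; apply: near_eq_cvg; near=> x.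
  have x0 : x != 0 by rewrite gt_eqF.
  by rewrite /= invfM invrK; move: (D x)^-1 => z; field.
move=> s t s0 st tL; have s0L : 0 < s < L by rewrite s0 (le_lt_trans st).
have t0L : 0 < t < L by rewrite tL (lt_le_trans s0).
rewrite -[leLHS]invrK -[leRHS]invrK lef_pV2 ?posrE ?invr_gt0 ?divr_gt0 ?y0 ?D0//.
rewrite !invf_div; apply: Dy => // x xL.
rewrite [p x * D x]mulrC -mulrA; apply: ler_wpM2l; last exact: concave.
by rewrite ltW ?D0.
Unshelve. all: by end_near. Qed.

(** * The affine parameter and the empty-cone distance *)

Lemma Omega1_gt0 (R : realType) (Omega z : R) :
  0 <= Omega -> 0 <= z -> 0 < Omega * z + 1.
Proof. by move=> O0 z0; rewrite ltr_wpDl// mulr_ge0. Qed.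

Lemma is_derive_sqrt_Omega1 (R : realType) (Omega z : R) :
  0 <= Omega -> 0 <= z ->
  is_derive z 1 (fun x => Num.sqrt (Omega * x + 1))
    (Omega / (2 * Num.sqrt (Omega * z + 1))).
Proof.
move=> O0 z0; have s0 := Omega1_gt0 _ _ _ O0 z0.
have H1 : is_derive z 1 (fun x : R => Omega * x + 1) Omega.
  have H := is_deriveD (is_deriveZ Omega (is_derive_id z 1)) (is_derive_cst (1 : R) z 1).
  by apply: (is_derive_eq H); rewrite addr0 -[_ *: _]/(_ * _) mulr1.
have H := @is_derive1_comp R Num.sqrt (fun x => Omega * x + 1) z _ _
  (is_derive1_sqrt s0) H1.
by apply: (is_derive_eq H); rewrite mulrC.
Qed.

Section affine_parameter.
Context (R : realType) (c H0 Omega : R).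
Context (hc : 0 < c) (hH0 : 0 < H0) (hOmega : 0 <= Omega).

Let phi (x : R) : R := ((1 + x) ^+ 3 * Num.sqrt (Omega * x + 1))^-1.
Let aff := affine_parameter c H0 Omega.
Let zof := redshift c H0 Omega.
Let B := beam c H0 Omega.
Let k : R := c / H0.

Let k0 : 0 < k. Proof. exact: divr_gt0. Qed.

Let phi0 x : 0 <= x -> 0 < phi x.
Proof.
move=> x0; rewrite invr_gt0 mulr_gt0// ?sqrtr_gt0 ?Omega1_gt0//.
by rewrite exprn_gt0// ltr_pwDl.
Qed.

Let phi_continuous x : 0 <= x -> {for x, continuous phi}.
Proof.
move=> x0; apply: cvgV; first by have := phi0 _ x0; rewrite invr_gt0 => /lt0r_neq0.
apply: cvgM; last first.
  exact: (@is_derive_continuous _ _ _ _ (is_derive_sqrt_Omega1 _ _ _ hOmega x0)).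
have c1 : {for x, continuous (fun y : R => 1 + y)}.
  by apply: cvgD; [exact: cvg_cst|exact: cvg_id].
exact: (cvg_comp _ _ c1 (@exprn_continuous _ 3 _)).
Qed.

Let phi_integrable u : lebesgue_measure.-integrable `[0, u] (EFin \o phi).
Proof.
apply: continuous_compact_integrable; first exact: segment_compact.
apply/continuous_in_subspaceT => x; rewrite inE/= in_itv/= => /andP[x0 _].
exact: phi_continuous.
Qed.

Lemma affine_parameter0 : aff 0 = 0.
Proof. by rewrite /aff /affine_parameter set_itv1 Rintegral_set1 mulr0. Qed.

Lemma is_derive_affine_parameter (z : R) : 0 < z -> is_derive z 1 aff (k * phi z).
Proof.
move=> z0.
(* Integrating up to [z + 1] makes [z] an interior point. *)
have zz : z < z + 1 by rewrite ltrDl.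
have [d1 d2] := @continuous_FTC1_closed R phi 0 z (z + 1)
  zz (phi_integrable _) z0 (phi_continuous _ (ltW z0)).
have d : is_derive z 1 (fun y => \int[lebesgue_measure]_(t in `[0, y]) phi t) (phi z).
  by split; [exact: d1|rewrite -derive1E].
by have := is_deriveZ k d; exact.
Qed.

Lemma affine_parameter_continuous u : 0 <= u -> {within `[0, u], continuous aff}.
Proof.
move=> u0.
have h := parameterized_integral_continuous u0 (phi_integrable u).
by move=> x; apply: cvgM; [exact: cvg_cst|exact: h].
Qed.

Lemma affine_parameter_lt s t : 0 <= s -> s < t -> aff s < aff t.
Proof.
move=> s0 st.
have [x||x] := @MVT R aff (fun z => k * phi z) s t st.
- rewrite in_itv/= => /andP[sx _]; apply: is_derive_affine_parameter.
  exact: le_lt_trans sx.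
- apply: continuous_subspaceW (affine_parameter_continuous t _).
    by move=> x /=; rewrite !in_itv/= => /andP[/(le_trans s0) -> ->].
  by rewrite ltW// (le_lt_trans s0).
rewrite in_itv/= => /andP[sx _] e; rewrite -subr_gt0 e mulr_gt0 ?subr_gt0//.
by rewrite mulr_gt0// phi0// ltW// (le_lt_trans s0).
Qed.

Lemma affine_parameterK z : 0 <= z -> zof (aff z) = z.
Proof.
move=> z0; apply: pinvKV; last by rewrite inE/= in_itv/= z0.
move=> x y; rewrite !inE/= !in_itv/= !andbT => x0 y0 xy.
by case: (ltgtP x y) => // /affine_parameter_lt; rewrite -/aff in xy;
  rewrite xy ltxx => /(_ _)/negP; case.
Qed.

Lemma beam_redshift l : B l -> 0 <= zof l /\ aff (zof l) = l.
Proof.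
by move=> [z /=]; rewrite in_itv/= andbT => z0 <-; rewrite affine_parameterK.
Qed.

Lemma beam_affine z : 0 <= z -> B (aff z).
Proof. by move=> z0; exists z => //=; rewrite in_itv/= z0. Qed.

Lemma beam0 : B 0.
Proof. by rewrite -affine_parameter0; exact: beam_affine. Qed.

Lemma affine_parameter_le s t : 0 <= s -> s <= t -> aff s <= aff t.
Proof.
move=> s0; rewrite le_eqVlt => /predU1P[->//|st].
by rewrite ltW// affine_parameter_lt.
Qed.

Lemma beam_ge0 l : B l -> 0 <= l.
Proof.
move=> /beam_redshift[z0 <-]; rewrite -affine_parameter0.
exact: affine_parameter_le.
Qed.

(** By the intermediate value theorem, since the affine parameter is continuous and starts at 0. *)
Lemma beam_le l m : B m -> 0 <= l <= m -> B l.
Proof.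
move=> /beam_redshift[]; move: (zof m) => z z0 <- /andP[l0 lz].
have [|x] := @IVT R aff 0 z l z0 (affine_parameter_continuous _ z0).
  by rewrite affine_parameter0 ge_min le_max l0 lz orbT.
by rewrite in_itv/= => /andP[x0 _] <-; exact: beam_affine.
Qed.

(** The redshift can always be raised, so the beam has no last point and its positive points are
    interior. *)
Lemma beam_gt l : B l -> exists2 m, l < m & B m.
Proof.
move=> /beam_redshift[]; move: (zof l) => z z0 <-.
exists (aff (z + 1)); first by rewrite affine_parameter_lt// ltrDl.
by apply: beam_affine; rewrite addr_ge0.
Qed.

Lemma beam_nbhs l : B l -> 0 < l -> nbhs l B.
Proof.
move=> Bl l0; have [m lm Bm] := beam_gt _ Bl.
have : \forall y \near l, y \in `]0, m[ by apply: near_in_itvoo; rewrite in_itv/= l0.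
apply: filterS => y; rewrite in_itv/= => /andP[y0 ym].
by apply: (@beam_le _ m) => //; rewrite !ltW.
Qed.

Lemma redshift_lt l z : B l -> 0 <= z -> l < aff z -> zof l < z.
Proof.
move=> Bl z0; have [z1 {1}<-] := beam_redshift _ Bl.
by apply: contraTT; rewrite -!leNgt => /affine_parameter_le; apply.
Qed.

(** Monotonicity suffices: the redshift is below [e] once [l] is below [aff e > 0]. *)
Lemma redshift_cvg0 : zof l @[l --> 0^'+] --> (0 : R).
Proof.
apply/cvgrPdist_lt => e e0.
have a0 : 0 < aff e by rewrite -affine_parameter0; exact: affine_parameter_lt.
near=> l.
have l0 : 0 < l by [].
have le : l < aff e by near: l; exact: nbhs_right_lt.
have Bl : B l by apply: (@beam_le _ (aff e)); [exact/beam_affine/ltW|rewrite !ltW].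
have [z0 _] := beam_redshift _ Bl.
by rewrite sub0r normrN ger0_norm// redshift_lt// ltW.
Unshelve. all: by end_near. Qed.

Lemma is_derive_redshift (l : R) : B l -> 0 < l ->
  is_derive l 1 zof (k * phi (zof l))^-1.
Proof.
move=> Bl l0; have [z0 e] := beam_redshift _ Bl.
(* At a positive redshift the affine parameter has a two-sided derivative, as the inverse function
   rule requires. *)
have {}z0 : 0 < zof l.
  rewrite lt_neqAle z0 andbT; apply/eqP => z0'.
  by move: l0; rewrite -e -z0' affine_parameter0 ltxx.
move: (zof l) z0 e => z z0 <-{l l0 Bl}.
apply: (@is_derive_inverse R aff zof).
- near=> x; apply: affine_parameterK; apply: ltW; near: x.
  exact: lt_nbhsr.
- near=> x; apply: is_derive_continuous; apply: is_derive_affine_parameter; near: x.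
  exact: lt_nbhsr.
- exact: is_derive_affine_parameter.
- by rewrite gt_eqF// mulr_gt0// phi0// ltW.
Unshelve. all: by end_near. Qed.

End affine_parameter.

(* [sqrt (Omega z + 1) / (1 + z)^2] solves the focusing equation of the
   homogeneous universe ([alpha = 1]) and vanishes at no redshift [z >= 0]. *)
Lemma empty_cone_distance_gt0 (R : realType) (c H0 Omega alpha : R)
    (Demp : R -> R) :
  0 < c -> 0 < H0 -> 0 <= Omega -> alpha <= 1 ->
  solves_ivp2 (beam c H0 Omega)
    (fun l d => R_bg c H0 Omega alpha l * d) 0 1 Demp ->
  forall l, beam c H0 Omega l -> 0 < l -> 0 < Demp l.
Proof.
move=> hc hH0 hO ha [D1 [Dd D1d D0 D10]] l Bl l0.
(* The comparison runs on an open interval []0, b[], which has to contain [l]. *)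
have [b lb Bb] := beam_gt _ _ _ _ hc hH0 hO _ Bl.
have b0 : 0 < b by exact: lt_trans lb.
have sub z : 0 <= z <= b -> beam c H0 Omega z.
  by move=> zb; exact: (beam_le _ _ _ _ hc hH0 hO _ _ Bb).
have B0 := sub 0; rewrite lexx ltW// in B0; have {}B0 := B0 isT.
have subo z : 0 < z < b -> nbhs z (beam c H0 Omega).
  by move=> /andP[z0 zb]; apply: beam_nbhs => //; apply: sub; rewrite !ltW.
have Bo z : 0 < z < b -> beam c H0 Omega z.
  by move=> zb; apply: nbhs_singleton; exact: subo.
pose zof := redshift c H0 Omega.
pose k := H0 / c.
pose s z := Num.sqrt (Omega * z + 1).
pose U z := s z / (1 + z) ^+ 2.
(* [u1] and [u2] are the derivatives of [u] in the affine parameter. The square roots cancel in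
   [u1], which is affine in the redshift. *)
pose u x := U (zof x).
pose u1 x := k * (Omega * (1 + zof x) / 2 - 2 * (Omega * zof x + 1)).
pose u2 x := - (3 / 2) * k ^+ 2 * Omega * (1 + zof x) ^+ 5 * u x.
have zof0 x : 0 < x < b -> 0 <= zof x.
  by move=> xb; have [] := beam_redshift _ _ _ _ hc hH0 hO _ (Bo _ xb).
have s0 z : 0 <= z -> 0 < s z by move=> z0; rewrite sqrtr_gt0 Omega1_gt0.
have ss z : 0 <= z -> s z ^+ 2 = Omega * z + 1.
  by move=> z0; rewrite sqr_sqrtr// ltW// Omega1_gt0.
have zd (x : R) : 0 < x < b -> is_derive x 1 zof (k * ((1 + zof x) ^+ 3 * s (zof x))).
  move=> xb; have /andP[x0 _] := xb.
  have H := is_derive_redshift _ _ _ _ hc hH0 hO _ (Bo _ xb) x0.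
  by apply: (is_derive_eq H); rewrite invfM invrK invf_div.
have id1 (z : R) : is_derive z 1 (fun y : R => 1 + y) 1.
  have H := is_deriveD (is_derive_cst (1 : R) z 1) (is_derive_id z 1).
  by apply: (is_derive_eq H); rewrite add0r.
have Ud (z : R) : 0 <= z -> is_derive z 1 U
    (Omega / (2 * s z * (1 + z) ^+ 2) - 2 * s z / (1 + z) ^+ 3).
  move=> z0; have z1 : (1 + z) ^+ 2 != 0 by rewrite expf_neq0// gt_eqF// ltr_pwDl.
  have H2 : is_derive z 1 (fun y : R => (1 + y) ^+ 2) (2 * (1 + z)).
    have H := is_deriveX 2 (id1 z).
    by apply: (is_derive_eq H); rewrite /= expr1 -[_ *: _]/(_ * _) mulr1.
  have H := is_deriveM (is_derive_sqrt_Omega1 _ _ _ hO z0)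
    (@is_deriveV R (fun y => (1 + y) ^+ 2) z _ 1 z1 H2).
  apply: (is_derive_eq H); rewrite -[_ *: _]/(_ * (_ * _)) -[_ *: _]/(_ * _) -/(s z).
  by field; rewrite !gt_eqF// ?s0// ltr_pwDl.
have ud (x : R) :  0 < x < b -> is_derive x 1 u (u1 x).
  move=> xb; have z0 := zof0 _ xb.
  have H := @is_derive1_comp R U zof x _ _ (Ud _ z0) (zd _ xb).
  apply: (is_derive_eq H); rewrite /u1 -(ss _ z0).
  by field; rewrite !gt_eqF// ?s0// ltr_pwDl.
have u1d (x : R) :  0 < x < b -> is_derive x 1 u1 (u2 x).
  move=> xb; have z0 := zof0 _ xb.
  pose V z := k * (Omega * (1 + z) / 2 - 2 * (Omega * z + 1)).
  have Vd (z : R) : is_derive z 1 V (- (3 / 2) * k * Omega).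
    have -> : V = (fun z : R => (- (3 / 2) * k * Omega) * z + k * (Omega / 2 - 2)).
      by apply/funext => y; rewrite /V; field.
    have H := is_deriveD (is_deriveZ (- (3 / 2) * k * Omega) (is_derive_id z 1))
      (is_derive_cst (k * (Omega / 2 - 2)) z 1).
    by apply: (is_derive_eq H); rewrite addr0 -[_ *: _]/(_ * _) mulr1.
  have H := @is_derive1_comp R V zof x _ _ (Vd _) (zd _ xb).
  apply: (is_derive_eq H); rewrite /u2 /u /U.
  by field; rewrite !gt_eqF// ltr_pwDl.
have zlim := redshift_cvg0 _ _ _ _ hc hH0 hO.
have id0 : (fun x : R => x) @ 0^'+ --> (0 : R) by exact: cvg_at_right_filter.
have ulim : u x @[x --> 0^'+] --> (1 : R).
  have H := cvg_comp _ _ zlim (is_derive_continuous _ _ _ _ (Ud 0 (lexx _))).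
  by move: H; rewrite /U /s mulr0 add0r sqrtr1 addr0 expr1n divr1; exact.
(* Existence of the limit is enough: in the Wronskian it is multiplied by the limit 0 of [Demp]. *)
have u1lim : exists l1 : R, u1 x @[x --> 0^'+] --> l1.
  eexists; apply: cvgM; first exact: cvg_cst.
  apply: cvgB.
    apply: cvgM; last exact: cvg_cst.
    by apply: cvgM; [exact: cvg_cst|apply: cvgD; [exact: cvg_cst|exact: zlim]].
  apply: cvgM; first exact: cvg_cst.
  by apply: cvgD; [apply: cvgM; [exact: cvg_cst|exact: zlim]|exact: cvg_cst].
have [l1 {}u1lim] := u1lim.
have Dq := is_derive_within_right_quotient _ _ _ _ _ b0 sub D0 (Dd _ B0).
have Dlim := is_derive_within_right_cvg _ _ _ _ _ b0 sub (Dd _ B0).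
have D1lim := is_derive_within_right_cvg _ _ _ _ _ b0 sub (D1d _ B0).
rewrite D0 in Dlim; rewrite D10 in Dq D1lim.
(* The final 1 is the limit of the Wronskian [D1 u - Demp u1] at 0. *)
apply: (@sturm_gt0 R Demp D1 (fun x => R_bg c H0 Omega alpha x * Demp x) u u1 u2 b 1
  _ _ ud u1d).
- by move=> x xb; apply: is_derive_within_interior (Dd _ (Bo _ xb)); exact: subo.
- by move=> x xb; apply: is_derive_within_interior (D1d _ (Bo _ xb)); exact: subo.
- move=> x xb; have z0 := zof0 _ xb.
  by rewrite divr_gt0// ?s0// exprn_gt0// ltr_pwDl.
- move=> x xb Dx0; have z0 := zof0 _ xb.
  have ux0 : 0 < u x by rewrite divr_gt0// ?s0// exprn_gt0// ltr_pwDl.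
  rewrite -subr_ge0.
  (* The two sources differ by the factor [alpha] against 1. The sign of the difference relies on
     [Demp x > 0], which [sturm_gt0] grants. *)
  have -> : R_bg c H0 Omega alpha x * Demp x * u x - Demp x * u2 x
     = (1 - alpha) * (3 / 2 * k ^+ 2 * Omega * (1 + zof x) ^+ 5 * Demp x * u x).
    by rewrite /R_bg /u2 -/zof -/k; field.
  rewrite mulr_ge0 ?subr_ge0//.
  do 2![apply: mulr_ge0; last exact: ltW].
  apply: mulr_ge0; last by rewrite exprn_ge0// addr_ge0.
  by apply: mulr_ge0 => //; apply: mulr_ge0; rewrite ?sqr_ge0.
- exact: ler01.
- rewrite (_ : nbhs (1 : R) = nbhs (1 * 1 - 0 * l1)).
    by apply: cvgB; apply: cvgM.
  by congr (nbhs _); ring.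
- near=> x; have x0 : 0 < x by [].
  have : 0 < Demp x / x by near: x; exact: cvgr_gt Dq _ ltr01.
  by rewrite pmulr_lgt0 ?invr_gt0.
- by rewrite l0.
Unshelve. all: by end_near. Qed.

(** * The Jacobi map *)

Lemma det_mx22 (R : comRingType) (M : 'M[R]_2) :
  \det M = M 0 0 * M 1 1 - M 0 1 * M 1 0.
Proof.
rewrite (expand_det_row _ 0) !big_ord_recl big_ord0 addr0 /cofactor !det_mx11 !mxE.
have -> : lift ord0 ord0 = 1 :> 'I_2 by exact/val_inj.
have -> : lift (1 : 'I_2) 0 = 0 :> 'I_2 by exact/val_inj.
by rewrite /= !expr0 expr1 mul1r mulN1r mulrN.
Qed.

Lemma signed_amplitude0 (R : realType) (Demp : R -> R) (J : R -> 'M[R]_2) :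
  signed_amplitude Demp J 0 = 1.
Proof.
by rewrite /signed_amplitude /amplification eqxx det1 normr1 sqrtr1 sgr1 mulr1.
Qed.

Lemma signed_amplitudeE (R : realType) (Demp : R -> R) (J : R -> 'M[R]_2)
    (l : R) :
  0 < l -> 0 < Demp l -> 0 <= \det (J l) ->
  signed_amplitude Demp J l = Num.sqrt (\det (J l)) / Demp l.
Proof.
move=> l0 D0 e0; rewrite /signed_amplitude /amplification gt_eqF// detZ.
move: (\det (J l)) e0 => e e0; have i0 : 0 <= (Demp l)^-1 by rewrite invr_ge0 ltW.
have d0 : 0 <= (Demp l)^-1 ^+ 2 * e by rewrite mulr_ge0// sqr_ge0.
rewrite (ger0_norm d0) sqrtrM ?sqr_ge0// sqrtr_sqr ger0_norm//.
(* For a zero determinant the sign is 0, and both sides vanish. *)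
move: e0; rewrite le_eqVlt => /predU1P[<-|e0].
  by rewrite sqrtr0 !mulr0 mul0r.
by rewrite gtr0_sg ?mul1r 1?mulrC// mulr_gt0// exprn_gt0// invr_gt0.
Qed.

(** A nonnegative amplitude rules out a negative determinant, so the absolute determinant is the
    square of the amplitude. *)
Lemma magnification_ge1 (R : realType) (Demp : R -> R) (J : R -> 'M[R]_2)
    (l : R) :
  0 <= signed_amplitude Demp J l <= 1 -> (1 <= magnification Demp J l)%E.
Proof.
rewrite /signed_amplitude /magnification; set d := \det _ => /andP[d0 d1].
case: eqVneq => [//|dn0]; first by rewrite leey.
rewrite lee_fin invf_ge1 ?normr_gt0//.
have {}d1 : Num.sqrt `|d| <= 1.
  apply: le_trans d1; move: d0.
  have s0 : 0 < Num.sqrt `|d| by rewrite sqrtr_gt0 normr_gt0.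
  rewrite pmulr_lge0// => sd.
  by rewrite (_ : Num.sg d = 1) ?mul1r//; move: sd dn0; case: sgrP => //; rewrite ?ler0N1.
rewrite -(sqr_sqrtr (normr_ge0 d)) expr_le1//.
Qed.

(** * Focusing along the beam *)

Section focusing_beam.
Context (R : realType) (c H0 Omega alpha : R)
  (hc : 0 < c) (hH0 : 0 < H0) (hOmega : 0 <= Omega) (halpha : alpha <= 1)
  (R_cl : R -> R) (F : R -> R[i])
  (hR_cl0 : forall l, beam c H0 Omega l -> R_cl l <= 0)
  (Demp : R -> R)
  (hDemp : solves_ivp2 (beam c H0 Omega)
             (fun l d => R_bg c H0 Omega alpha l * d) 0 1 Demp)
  (J : R -> 'M[R]_2)
  (hJ : solves_ivp2 (beam c H0 Omega)
          (fun l M =>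
             tidal_matrix (R_bg c H0 Omega alpha l + R_cl l) (F l) *m M)
          0 1%:M J).

Let B := beam c H0 Omega.

(** The point [t] may itself be conjugate: [focusing_scalar] is applied on []0, t[], and the
    conclusions at [t] follow by continuity. *)
Lemma focusing_before_conjugate (t : R) : B t -> 0 < t ->
  (forall l, l < t -> ~ conjugate_point B J l) ->
  [/\ 0 <= \det (J t), Num.sqrt (\det (J t)) / Demp t <= 1
    & forall s, 0 < s -> s <= t ->
        Num.sqrt (\det (J t)) / Demp t <= Num.sqrt (\det (J s)) / Demp s].
Proof.
move=> Bt t0 nc.
have Dgt0 := empty_cone_distance_gt0 _ _ _ _ _ _ hc hH0 hOmega halpha hDemp.
have [D1 [Dd D1d D0 D10]] := hDemp.
have [J1 [Jd J1d J0 J10]] := hJ.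
have sub z : 0 <= z <= t -> B z by exact: beam_le.
have B0 : B 0 by apply: sub; rewrite lexx ltW.
have Bo z : 0 < z < t -> B z by move=> /andP[z0 zt]; apply: sub; rewrite !ltW.
have nb z : 0 < z < t -> nbhs z B.
  by move=> zt; apply: beam_nbhs => //; [exact: Bo|case/andP: zt].
pose a z := J z 0 0; pose b z := J z 0 1; pose c' z := J z 1 0; pose d z := J z 1 1.
pose e z := a z * d z - b z * c' z.
have eE z : \det (J z) = e z by rewrite det_mx22.
have cont z i j : 0 < z -> B z -> {for z, continuous (fun x => J x i j : R)}.
  move=> z0 Bz; apply: is_derive_continuous.
  exact: is_derive_within_interior (beam_nbhs _ _ _ _ hc hH0 hOmega _ Bz z0)
    (is_derive_within_coord _ _ _ _ _ _ _ i j (Jd _ Bz)).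
have econt z : 0 < z -> B z -> {for z, continuous e}.
  by move=> z0 Bz; apply: cvgB; apply: cvgM; exact: cont.
have quot i j : J x i j / x @[x --> 0^'+] --> ((i == j)%:R : R).
  have h := is_derive_within_coord _ _ _ _ _ _ _ i j (Jd _ B0).
  have := is_derive_within_right_quotient _ _ _ _ _ t0 sub _ h.
  by rewrite J0 J10 !mxE; exact.
have lim1 i j : J1 x i j @[x --> 0^'+] --> ((i == j)%:R : R).
  have h := is_derive_within_coord _ _ _ _ _ _ _ i j (J1d _ B0).
  have := is_derive_within_right_cvg _ _ _ _ _ t0 sub h.
  by rewrite J10 !mxE; exact.
have enear : \forall x \near 0^'+, 0 < e x.
  have h : a x / x * (d x / x) - b x / x * (c' x / x) @[x --> 0^'+] --> (1 * 1 - 0 * 0 : R).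
    by apply: cvgB; apply: cvgM; exact: quot.
  rewrite mulr1 mulr0 subr0 in h.
  near=> x; have x0 : 0 < x by [].
  have : 0 < a x / x * (d x / x) - b x / x * (c' x / x).
    by near: x; exact: cvgr_gt h _ ltr01.
  have -> : a x / x * (d x / x) - b x / x * (c' x / x) = e x * x^-1 ^+ 2.
    by rewrite /e; ring.
  by rewrite pmulr_lgt0// exprn_gt0// invr_gt0.
(* The determinant behaves like [x^2] near 0; to become nonpositive it would have to vanish, at a
   conjugate point before [t]. *)
have epos x : 0 < x < t -> 0 < e x.
  move=> /andP[x0 xt]; rewrite ltNge; apply/negP => ex.
  have [s [s0 sx es]] : exists s, [/\ 0 < s, s < x & 0 < e s].
    near (0:R)^'+ => s; exists s; split => //; near: s => //; exact: nbhs_right_lt.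
  have [||z] := @IVT R e s x 0 (ltW sx) _ _.
  - apply/continuous_in_subspaceT => z; rewrite inE/= in_itv/= => /andP[sz zx].
    have z0 : 0 < z by exact: lt_le_trans sz.
    by apply: econt => //; apply: Bo; rewrite z0 (le_lt_trans zx).
  - by rewrite ge_min ex orbT le_max (ltW es).
  rewrite in_itv/= => /andP[sz zx] ez; apply: (nc z); first exact: le_lt_trans xt.
  have z0 : 0 < z by exact: lt_le_trans sz.
  by split; [apply: Bo; rewrite z0 (le_lt_trans zx)|by []|rewrite eE].
have limE : e x @[x --> t^'-] --> e t by apply: cvg_at_left_filter; exact: econt.
have et : 0 <= e t.
  have <- : lim (e x @[x --> t^'-]) = e t by exact: cvg_lim limE.
  apply: limr_ge; first exact: cvgP limE.
  near=> x; have xt : x < t by [].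
  apply/ltW/epos; rewrite xt andbT.
  by near: x; exact: nbhs_left_gt.
pose r x := R_bg c H0 Omega alpha x + R_cl x.
have col j : jacobi_column t r (fun x => complex.Re (F x)) (fun x => complex.Im (F x))
   (fun x => J x 0 j) (fun x => J x 1 j) (fun x => J1 x 0 j) (fun x => J1 x 1 j).
  move=> x xt; have Bx := Bo _ xt; have nx := nb _ xt.
  have h1 i := is_derive_within_interior _ _ _ _ _ nx
    (is_derive_within_coord _ _ _ _ _ _ _ i j (Jd _ Bx)).
  have h2 i := is_derive_within_interior _ _ _ _ _ nx
    (is_derive_within_coord _ _ _ _ _ _ _ i j (J1d _ Bx)).
  have l1 : lift ord0 ord0 = 1 :> 'I_2 by exact/val_inj.
  split; [exact: h1|exact: h1| |]; apply: (is_derive_eq (h2 _));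
    by rewrite mxE !big_ord_recl big_ord0 addr0 !mxE l1.
have rp x : 0 < x < t -> r x <= R_bg c H0 Omega alpha x.
  by move=> xt; rewrite gerDl hR_cl0//; exact: Bo.
have Dq := is_derive_within_right_quotient _ _ _ _ _ t0 sub D0 (Dd _ B0).
have D1lim := is_derive_within_right_cvg _ _ _ _ _ t0 sub (D1d _ B0).
rewrite D10 in Dq D1lim.
have [ylim mono] := focusing_scalar R t (R_bg c H0 Omega alpha) r _ _ Demp D1 _ _ _ _ _ _ _ _
  (col 0) (col 1)
  (fun x xt => is_derive_within_interior _ _ _ _ _ (nb _ xt) (Dd _ (Bo _ xt)))
  (fun x xt => is_derive_within_interior _ _ _ _ _ (nb _ xt) (D1d _ (Bo _ xt)))
  (fun x xt => Dgt0 _ (Bo _ xt) (proj1 (andP xt))) rp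
  (quot 0 0) (quot 1 0) (quot 0 1) (quot 1 1) Dq
  (lim1 0 0) (lim1 1 0) (lim1 0 1) (lim1 1 1) D1lim epos.
have {mono} : forall s, 0 < s -> s <= t ->
    Num.sqrt (e t) / Demp t <= Num.sqrt (e s) / Demp s.
  move=> s s0; rewrite le_eqVlt => /predU1P[->//|st].
  have limt : Num.sqrt (e x) / Demp x @[x --> t^'-] --> Num.sqrt (e t) / Demp t.
    apply: cvgM; first exact: cvg_comp _ _ limE (@sqrt_continuous R _).
    apply: cvgV; first by rewrite gt_eqF// Dgt0.
    apply: cvg_at_left_filter; apply: is_derive_continuous.
    exact: is_derive_within_interior (beam_nbhs _ _ _ _ hc hH0 hOmega _ Bt t0) (Dd _ Bt).
  have <- : lim (Num.sqrt (e x) / Demp x @[x --> t^'-]) = Num.sqrt (e t) / Demp t.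
    exact: cvg_lim limt.
  apply: limr_le; first exact: cvgP limt.
  near=> x; have xt : x < t by [].
  apply: mono => //; near: x; exact: nbhs_left_ge.
move=> mono; rewrite eE; split => //; last by move=> s s0 st; rewrite eE mono.
(* The bound 1 is the limit at 0 of the nonincreasing ratio. *)
have <- : lim (Num.sqrt (e x) / Demp x @[x --> 0^'+]) = 1 by exact: cvg_lim ylim.
apply: limr_ge; first exact: cvgP ylim.
near=> x; have x0 : 0 < x by [].
apply: mono => //; near: x; exact: nbhs_right_ltW.
Unshelve. all: by end_near. Qed.

Lemma signed_amplitude_nonincreasing (l1 l2 : R) : B l2 -> 0 <= l1 -> l1 <= l2 ->
  (forall l, l < l2 -> ~ conjugate_point B J l) ->
  signed_amplitude Demp J l2 <= signed_amplitude Demp J l1.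
Proof.
move=> B2 l10; rewrite le_eqVlt => /predU1P[->//|l12] nc.
have l20 : 0 < l2 by exact: le_lt_trans l12.
have Dgt0 := empty_cone_distance_gt0 _ _ _ _ _ _ hc hH0 hOmega halpha hDemp.
have [e2 a2 mono] := focusing_before_conjugate _ B2 l20 nc.
rewrite (signed_amplitudeE _ _ _ _ l20 (Dgt0 _ B2 l20) e2).
(* At [l1 = 0] the amplitude is 1 by convention, and the claim is the bound [a2]. *)
move: (l10); rewrite le_eqVlt => /predU1P[<-|{}l10]; first by rewrite signed_amplitude0.
have B1 : B l1 by apply: (beam_le _ _ _ _ hc hH0 hOmega _ _ B2); rewrite !ltW.
have [e1 _ _] : [/\ 0 <= \det (J l1), _ & _] := focusing_before_conjugate _ B1 l10
  (fun l ll1 => nc _ (lt_trans ll1 l12)).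
by rewrite (signed_amplitudeE _ _ _ _ l10 (Dgt0 _ B1 l10) e1) mono// ltW.
Qed.

Lemma signed_amplitude_bounds (l : R) : B l ->
  (forall m, m < l -> ~ conjugate_point B J m) ->
  0 <= signed_amplitude Demp J l <= 1.
Proof.
move=> Bl nc; have := beam_ge0 _ _ _ _ hc hH0 hOmega _ Bl.
rewrite le_eqVlt => /predU1P[<-|l0]; first by rewrite signed_amplitude0 ler01 lexx.
have Dl : 0 < Demp l.
  exact: (empty_cone_distance_gt0 _ _ _ _ _ _ hc hH0 hOmega halpha hDemp).
have [e0 a1 _] := focusing_before_conjugate _ Bl l0 nc.
rewrite (signed_amplitudeE _ _ _ _ l0 Dl e0) a1 andbT.
by rewrite divr_ge0 ?sqrtr_ge0// ltW.
Qed.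

End focusing_beam.

Theorem mainTheorem6 (R : realType) (c H0 Omega alpha : R)
    (hc : 0 < c) (hH0 : 0 < H0) (hOmega : 0 <= Omega)
    (halpha : 0 <= alpha <= 1)
    (R_cl : R -> R) (F : R -> R[i])
    (hR_cl : {within beam c H0 Omega, continuous R_cl})
    (hF : {within beam c H0 Omega, continuous (F : R -> (R[i] : numFieldType))})
    (hR_cl0 : forall l, beam c H0 Omega l -> R_cl l <= 0)
    (Demp : R -> R)
    (hDemp : solves_ivp2 (beam c H0 Omega)
               (fun l d => R_bg c H0 Omega alpha l * d) 0 1 Demp)
    (J : R -> 'M[R]_2)
    (hJ : solves_ivp2 (beam c H0 Omega)
            (fun l M =>
               tidal_matrix (R_bg c H0 Omega alpha l + R_cl l) (F l) *m M)
            0 1%:M J) :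
  [/\ forall lc, first_conjugate_point (beam c H0 Omega) J lc ->
        forall l, 0 <= l <= lc ->
          0 <= signed_amplitude Demp J l <= 1
          /\ (1 <= magnification Demp J l)%E,
      (forall l, ~ conjugate_point (beam c H0 Omega) J l) ->
        forall l, beam c H0 Omega l ->
          0 <= signed_amplitude Demp J l <= 1
          /\ (1 <= magnification Demp J l)%E
    & forall l1 l2, beam c H0 Omega l2 -> 0 <= l1 -> l1 <= l2 ->
        (forall l, l < l2 -> ~ conjugate_point (beam c H0 Omega) J l) ->
        signed_amplitude Demp J l2 <= signed_amplitude Demp J l1].
Proof.
have [a0 a1] := andP halpha.
have bounds := signed_amplitude_bounds _ _ _ _ _ hc hH0 hOmega a1 _ _ hR_cl0 _ hDemp _ hJ.
split.
- move=> lc [[Blc lc0 _] lcmin] l l_lc.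
  have Bl := beam_le _ _ _ _ hc hH0 hOmega _ _ Blc l_lc.
  have h : 0 <= signed_amplitude Demp J l <= 1.
    (* A conjugate point [m < l <= lc] would contradict the minimality of [lc]. *)
    apply: bounds => // m ml /lcmin; apply/negP; rewrite -ltNge.
    by apply: lt_le_trans ml _; case/andP: l_lc.
  by split=> //; exact: magnification_ge1.
- move=> nc l Bl; have h := bounds _ Bl (fun m _ => nc m).
  by split=> //; exact: magnification_ge1.
exact: (signed_amplitude_nonincreasing _ _ _ _ _ hc hH0 hOmega a1 _ _ hR_cl0 _ hDemp _ hJ).
Qed.
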